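(* Let $d\in\{2,3\}$ and $n\ge d$. Let $\{c_i\}_{i=1}^n$ be a positive sequence which is irregular with respect to $d$, with irregularity $k_0\ge 1$; without loss of generality (re-indexing) the sequence is assumed to be non-increasing, $c_1\ge\dots\ge c_n>0$. For unit vectors $g_1,\dots,g_n\in\mathbb{R}^d$ let $G=\sum_{i=1}^n c_i^2 g_ig_i^T$. Then $$\|G\|^2\ \ge\ \sum_{i=1}^{k_0}c_i^4+\frac{1}{d-k_0}\left(\sum_{i=k_0+1}^n c_i^2\right)^2 ,$$ and this lower bound is achieved by $\{g_i\}_{i=1}^n$ (i.e. equality holds) if and only if $\{g_i\}_{i=1}^{n}=\{g_i\}_{i=1}^{k_0}\cup\{g_i\}_{i=k_0+1}^n$, where $\{g_i\}_{i=1}^{k_0}$ is an orthogonal set (pairwise orthogonal vectors) and $\{g_i\}_{i=k_0+1}^n$ forms a regular optimal placement, with coefficients $\{c_i\}_{i=k_0+1}^n$, in the $(d-k_0)$-dimensional orthogonal complement of the span of $\{g_i\}_{i=1}^{k_0}$.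
   Context: $\|\cdot\|$ is the Frobenius norm of a matrix. Irregularity: for a positive non-increasing sequence $c_1\ge\dots\ge c_n>0$ and an integer $d$ with $1\le d\le n$, the irregularity $k_0$ of the sequence with respect to $d$ is the smallest nonnegative integer $k$ for which $$c_{k+1}^2\le\frac{1}{d-k}\sum_{i=k+1}^n c_i^2 .$$ It exists and satisfies $0\le k_0\le d-1$ (the index $k=d-1$ always satisfies the inequality). The sequence is regular if $k_0=0$ and irregular if $1\le k_0\le d-1$. Regular optimal placement in a subspace: if $W$ is an $m$-dimensional subspace of $\mathbb{R}^d$ and $\{c_i\}_{i\in I}$ are positive coefficients, unit vectors $\{g_i\}_{i\in I}$ form a regular optimal placement in $W$ if all $g_i\in W$ and $\sum_{i\in I}c_i^2 g_ig_i^T=\frac1m\sum_{i\in I}c_i^2\,\Pi_W$, where $\Pi_W$ is the orthogonal projection onto $W$ (i.e. the operator $\sum_{i\in I} c_i^2g_ig_i^T$ restricted to $W$ equals $\frac1m\sum_{i\in I}c_i^2$ times the identity of $W$). *)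

(* Defs.v *)
From HB Require Import structures.
From mathcomp Require Import all_boot all_order all_algebra.
From mathcomp Require Import sesquilinear reals.

Set Implicit Arguments.
Unset Strict Implicit.
Unset Printing Implicit Defensive.

Import Order.TTheory GRing.Theory Num.Theory.
Local Open Scope ring_scope.

(* The norm `|A| that the libraries put on matrices is the sup norm, hence this
   definition.  On column vectors [frobenius] is the Euclidean norm. *)
Definition frobenius (R : rcfType) (m n : nat) (A : 'M[R]_(m, n)) : R :=
  Num.sqrt (\sum_i \sum_j A i j ^+ 2).

Definition dotcv (R : rcfType) (d : nat) (u v : 'cV[R]_d) : R :=
  (u^T *m v) 0 0.

Section DotProduct.
Variables (R : rcfType) (d : nat).
Implicit Types u v : 'cV[R]_d.

Lemma dotcvE u v : dotcv u v = \sum_k u k 0 * v k 0.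
Proof. by rewrite /dotcv mxE; apply: eq_bigr => k _; rewrite mxE. Qed.

Let dotcv_linear_l v : GRing.linear_for *%R (fun u => dotcv u v).
Proof. by move=> a u w; rewrite /dotcv linearP /= mulmxDl -scalemxAl !mxE. Qed.

Let dotcv_linear_r u : GRing.linear_for (idfun \; *%R) (dotcv u).
Proof. by move=> a v w; rewrite /dotcv linearP /= !mxE. Qed.

HB.instance Definition _ :=
  bilinear_isBilinear.Build R 'cV[R]_d 'cV[R]_d R *%R (idfun \; *%R)
    (@dotcv R d) (dotcv_linear_l, dotcv_linear_r).

Let dotcv_sym u v : dotcv u v = (-1) ^+ false * idfun (dotcv v u).
Proof.
by rewrite expr0 mul1r /= !dotcvE; apply: eq_bigr => k _; rewrite mulrC.
Qed.

HB.instance Definition _ :=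
  isHermitianSesquilinear.Build R 'cV[R]_d false idfun (@dotcv R d) dotcv_sym.

Let dotcv_gt0 u : u != 0 -> 0 < dotcv u u.
Proof.
move=> u0; rewrite dotcvE lt_def sumr_ge0 => [|k _]; last by rewrite -expr2 sqr_ge0.
rewrite andbT; apply: contraNneq u0 => /eqP.
rewrite psumr_eq0 => [/allP u0|k _]; last by rewrite -expr2 sqr_ge0.
apply/eqP/matrixP => i j; rewrite ord1 mxE.
by have := u0 i (mem_index_enum _); rewrite /= mulf_eq0 orbb => /eqP.
Qed.

HB.instance Definition _ :=
  isDotProduct.Build R 'cV[R]_d (@dotcv R d) dotcv_gt0.

End DotProduct.

Definition orthocv (R : rcfType) (d : nat) (W : {vspace 'cV[R]_d}) :
  {vspace 'cV[R]_d} := orthov (@dotcv R d) W.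

Definition orthproj (R : rcfType) (d : nat) (W : {vspace 'cV[R]_d}) : 'M[R]_d :=
  \matrix_(i, j) daddv_pi W (orthocv W) (delta_mx j 0) i 0.

Section OrthogonalProjection.
Variables (R : rcfType) (d : nat).
Implicit Types (u v w : 'cV[R]_d) (W : {vspace 'cV[R]_d}).

Lemma orthocvP W u :
  reflect {in W, forall w, dotcv u w = 0} (u \in orthocv W).
Proof. exact: mem_orthovP. Qed.

Lemma capv_orthocv W : (W :&: orthocv W = 0)%VS.
Proof.
apply/eqP; rewrite -subv0; apply/subvP => u; rewrite memv_cap memv0.
case/andP=> uW /orthocvP/(_ u uW) uu0; apply/negPn/negP => u0.
have : 0 < dotcv u u := neq0_dnorm_gt0 _ u0.
by rewrite uu0 ltxx.
Qed.

Lemma mul_orthproj W v : orthproj W *m v = daddv_pi W (orthocv W) v.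
Proof.
have {2}-> : v = \sum_j v j 0 *: delta_mx j 0.
  by rewrite {1}[v]matrix_sum_delta; apply: eq_bigr => j _; rewrite big_ord1.
rewrite linear_sum; apply/matrixP => i j; rewrite ord1 summxE mxE.
by apply: eq_bigr => k _; rewrite linearZ !mxE mulrC.
Qed.

Lemma orthproj_id W w : w \in W -> orthproj W *m w = w.
Proof. by move=> wW; rewrite mul_orthproj daddv_pi_id ?capv_orthocv. Qed.

Lemma orthproj_orthocv W w : w \in orthocv W -> orthproj W *m w = 0.
Proof.
move=> wW; have C : (orthocv W :&: W = 0)%VS by rewrite capvC capv_orthocv.
have := daddv_pi_add (capv_orthocv W) (subvP (addvSr W _) _ wW).
by rewrite (daddv_pi_id C wW) -mul_orthproj -[RHS]add0r => /addIr.
Qed.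

End OrthogonalProjection.

(* Indices start at 0, so [c k] is the (k+1)-st term of the sequence. *)
Definition irregularity_cond (R : realFieldType) (d n : nat) (c : 'I_n -> R)
    (k : 'I_n) : Prop :=
  (k < d)%N /\
  c k ^+ 2 <= (d - k)%:R^-1 * \sum_(i < n | (k <= i)%N) c i ^+ 2.

Definition is_irregularity (R : realFieldType) (d n : nat) (c : 'I_n -> R)
    (k0 : 'I_n) : Prop :=
  irregularity_cond d c k0 /\
  forall k : 'I_n, irregularity_cond d c k -> (k0 <= k)%N.

Lemma irregularity_exists (R : realFieldType) (d n : nat) (c : 'I_n -> R) :
  (0 < d <= n)%N -> exists k0 : 'I_n, is_irregularity d c k0.
Proof.
case/andP=> d0 dn; have kn : (d.-1 < n)%N by rewrite prednK.
pose P (k : 'I_n) :=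
  (k < d)%N && (c k ^+ 2 <= (d - k)%:R^-1 * \sum_(i < n | (k <= i)%N) c i ^+ 2).
have P1 : P (Ordinal kn).
  have -> : P (Ordinal kn) = (c (Ordinal kn) ^+ 2 <=
      \sum_(i < n | (d.-1 <= i)%N) c i ^+ 2).
    by rewrite /P /= -[X in (X - _)%N](prednK d0) subSnn invr1 mul1r prednK ?leqnn.
  rewrite (bigD1 (Ordinal kn)) //= lerDl.
  by apply: sumr_ge0 => i _; apply: sqr_ge0.
case: (arg_minnP (fun k : 'I_n => k : nat) P1) => k /andP[kd ck] kmin.
exists k; split; first by split.
by move=> j [jd cj]; apply: kmin; apply/andP.
Qed.

(* The index set of the placement is [A]; values of [c] and [g] outside it are
   ignored. *)
Definition regular_optimal_placement (R : rcfType) (d m : nat)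
    (W : {vspace 'cV[R]_d}) (I : finType) (A : {set I})
    (c : I -> R) (g : I -> 'cV[R]_d) : Prop :=
  [/\ (\dim W = m)%N,
      {in A, forall i, frobenius (g i) = 1},
      {in A, forall i, g i \in W} &
      \sum_(i in A) c i ^+ 2 *: (g i *m (g i)^T)
        = (m%:R^-1 * \sum_(i in A) c i ^+ 2) *: orthproj W].

(* Main.v *)
Require Import Defs.
From mathcomp Require Import all_boot all_order all_algebra.
From mathcomp Require Import sesquilinear reals.

(** Put [a i = c i ^+ 2], [lam = (d - k0)^-1 * \sum_(i >= k0) a i] and
    [b i = a i - lam]; irregularity makes [b] nonnegative and non-increasing on
    the indices [i < k0].  Let [e] be a Gram-Schmidt basis adapted to the flag
    spanned by the first [k0] vectors [g i], and compare [G] with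
    [X = lam I + \sum_(i < k0) b i e_i e_i^T], whose squared norm is the bound:
      |G|^2 = |X|^2 + 2 <X, G - X> + |G - X|^2.
    The middle term is nonnegative: for [l < k0] the coordinates of the unit
    vector [g l] are carried by the [e i] with [i <= l], where [b i >= b l].
    Equality forces [G = X]; then [e_i^T G e_i = a i] forces every [g l] to be
    orthogonal to the [e i] with [i < l], so [g i] is [e i] up to sign for
    [i < k0], and what is left of [G = X] is the placement identity. *)

Set Implicit Arguments.
Unset Strict Implicit.
Unset Printing Implicit Defensive.

Import Order.TTheory GRing.Theory Num.Theory.
Local Open Scope ring_scope.

(** * The trace inner product on square matrices and its values on rank-one matrices *)

Section FrobeniusProduct.
Variables (R : rcfType) (d : nat).
Implicit Types (A B : 'M[R]_d) (u v : 'cV[R]_d).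

Definition fdot A B : R := \tr (A^T *m B).

Lemma fdotDl A B C : fdot (A + B) C = fdot A C + fdot B C.
Proof. by rewrite /fdot linearD /= mulmxDl mxtraceD. Qed.

Lemma fdotZl x A B : fdot (x *: A) B = x * fdot A B.
Proof. by rewrite /fdot linearZ /= -scalemxAl mxtraceZ. Qed.

Lemma fdot_suml I r (P : pred I) (F : I -> 'M[R]_d) B :
  fdot (\sum_(i <- r | P i) F i) B = \sum_(i <- r | P i) fdot (F i) B.
Proof. by rewrite /fdot linear_sum /= mulmx_suml linear_sum. Qed.

Lemma fdotC A B : fdot A B = fdot B A.
Proof. by rewrite /fdot -mxtrace_tr trmx_mul trmxK. Qed.

Lemma fdot_id1 A : fdot 1%:M A = \tr A.
Proof. by rewrite /fdot trmx1 mul1mx. Qed.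

Lemma frobenius_sqr m n (A : 'M[R]_(m, n)) :
  frobenius A ^+ 2 = \sum_i \sum_j A i j ^+ 2.
Proof.
rewrite /frobenius sqr_sqrtr //.
by apply: sumr_ge0 => i _; apply: sumr_ge0 => j _; apply: sqr_ge0.
Qed.

Lemma fdotE A : fdot A A = frobenius A ^+ 2.
Proof.
rewrite frobenius_sqr /fdot /mxtrace exchange_big /=; apply: eq_bigr => i _.
by rewrite mxE; apply: eq_bigr => j _; rewrite mxE expr2.
Qed.

Lemma frobenius_sqr_eq0 A : (frobenius A ^+ 2 == 0) = (A == 0).
Proof.
rewrite frobenius_sqr; apply/eqP/eqP => [A0|->]; last first.
  by apply: big1 => i _; apply: big1 => j _; rewrite mxE expr0n.
have s0 i : 0 <= \sum_j A i j ^+ 2 by apply: sumr_ge0 => j _; apply: sqr_ge0.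
apply/matrixP => i j; rewrite mxE; apply/eqP; rewrite -sqrf_eq0.
move/psumr_eq0P : A0 => /(_ (fun i _ => s0 i)) A0.
by move/psumr_eq0P : (A0 i isT) => -> // k _; apply: sqr_ge0.
Qed.

Lemma frobenius_sqrD A B :
  frobenius (A + B) ^+ 2 = frobenius A ^+ 2 + 2 * fdot A B + frobenius B ^+ 2.
Proof.
rewrite -!fdotE fdotDl ![fdot _ (A + B)]fdotC !fdotDl [fdot B A]fdotC.
by rewrite mulr_natl mulr2n !addrA.
Qed.

Lemma dotcvC u v : dotcv u v = dotcv v u.
Proof. by rewrite !dotcvE; apply: eq_bigr => k _; rewrite mulrC. Qed.

Lemma fdot_rank1 u v : fdot (u *m u^T) (v *m v^T) = dotcv u v ^+ 2.
Proof.
rewrite /fdot trmx_mul trmxK -mulmxA [u^T *m _]mulmxA [u^T *m v]mx11_scalar.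
rewrite mul_scalar_mx -scalemxAr mxtraceZ mxtrace_mulC /mxtrace big_ord1.
by rewrite -/(dotcv v u) -/(dotcv u v) [dotcv v u]dotcvC expr2.
Qed.

Lemma mxtrace_rank1 u : \tr (u *m u^T) = dotcv u u.
Proof. by rewrite mxtrace_mulC /mxtrace big_ord1. Qed.

Lemma frobenius_cv u : frobenius u ^+ 2 = dotcv u u.
Proof.
by rewrite frobenius_sqr dotcvE; apply: eq_bigr => i _; rewrite big_ord1 expr2.
Qed.

Lemma dotcvDr u v w : dotcv u (v + w) = dotcv u v + dotcv u w.
Proof. exact: linearDr. Qed.

Lemma dotcvBr u v w : dotcv u (v - w) = dotcv u v - dotcv u w.
Proof. exact: linearBr. Qed.

Lemma dotcvZr x u v : dotcv u (x *: v) = x * dotcv u v.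
Proof. exact: linearZr_LR. Qed.

Lemma dotcvZl x u v : dotcv (x *: u) v = x * dotcv u v.
Proof. exact: linearZl_LR. Qed.

Lemma dotcv_sumr I r (P : pred I) (F : I -> 'cV[R]_d) u :
  dotcv u (\sum_(i <- r | P i) F i) = \sum_(i <- r | P i) dotcv u (F i).
Proof. exact: linear_sumr. Qed.

Lemma rank1_mul u v : u *m u^T *m v = dotcv u v *: u.
Proof. by rewrite -mulmxA [u^T *m v]mx11_scalar mul_mx_scalar. Qed.

End FrobeniusProduct.

(** * Orthonormal families, their spans and orthogonal complements *)

Section Orthonormal.
Variables (R : rcfType) (d : nat) (I : finType).
Implicit Types (u v : 'cV[R]_d) (e : I -> 'cV[R]_d) (P : pred I).

Definition orthonormal_on P e :=
  forall i j, P i -> P j -> dotcv (e i) (e j) = (i == j)%:R.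

Definition span_on P e := <<[seq e i | i <- enum I & P i]>>%VS.

Definition proj_on P e v := \sum_(i | P i) dotcv (e i) v *: e i.

Lemma mem_span_on P e i : P i -> e i \in span_on P e.
Proof. by move=> Pi; apply/memv_span/map_f; rewrite mem_filter Pi mem_enum. Qed.

Lemma mem_proj_on P e v : proj_on P e v \in span_on P e.
Proof. by apply: memv_suml => i Pi; apply/memvZ/mem_span_on. Qed.

(** The vectors orthogonal to [u] form a subspace, so it contains the span of [s] as soon as it
    contains [s]. Symmetry of the dot product moves [u] to the other side. *)
Lemma orthocv_spanP (s : seq 'cV[R]_d) u :
  reflect {in s, forall w, dotcv u w = 0} (u \in orthocv <<s>>).
Proof.
rewrite /orthocv mem_orthov_sym; apply: (iffP span_subvP) => us w /us.
  by rewrite mem_orthov1 => /eqP wu; rewrite dotcvC.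
by move=> uw; rewrite mem_orthov1; apply/eqP; rewrite -[LHS]/(dotcv w u)
  dotcvC.
Qed.

Lemma orthocv_span_onP P e u :
  (forall i, P i -> dotcv (e i) u = 0) -> u \in orthocv (span_on P e).
Proof.
move=> eu; apply/orthocv_spanP => _ /mapP[i + ->].
by rewrite mem_filter => /andP[Pi _]; rewrite dotcvC eu.
Qed.

Variables (P : pred I) (e : I -> 'cV[R]_d).
Hypothesis eP : orthonormal_on P e.

Lemma dotcv_proj_on i v : P i -> dotcv (e i) (proj_on P e v) = dotcv (e i) v.
Proof.
move=> Pi; rewrite dotcv_sumr (bigD1 i) //= big1 => [|j /andP[Pj ji]].
  by rewrite dotcvZr eP // eqxx mulr1 addr0.
by rewrite dotcvZr eP // eq_sym (negPf ji) mulr0.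
Qed.

Lemma proj_on_orthocv v : v - proj_on P e v \in orthocv (span_on P e).
Proof.
by apply: orthocv_span_onP => i Pi; rewrite dotcvBr dotcv_proj_on // subrr.
Qed.

(** The residue lies both in the span and in its orthogonal complement, which meet only in 0. *)
Lemma proj_on_id v : v \in span_on P e -> v = proj_on P e v.
Proof.
move=> vV; apply/eqP; rewrite -subr_eq0 -memv0 -(capv_orthocv (span_on P e)).
by rewrite memv_cap proj_on_orthocv rpredB // mem_proj_on.
Qed.

(** Both sides act alike on every vector: split [v] into [proj_on P e v], which is killed, and its
    residue, which is fixed. This turns the placement identity into one between explicit
    matrices. *)
Lemma orthproj_orthocv_span_on :
  orthproj (orthocv (span_on P e)) = 1%:M - \sum_(i | P i) e i *m (e i)^T.
Proof.
have act v : orthproj (orthocv (span_on P e)) *m v =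
             (1%:M - \sum_(i | P i) e i *m (e i)^T) *m v.
  have -> : (1%:M - \sum_(i | P i) e i *m (e i)^T) *m v = v - proj_on P e v.
    rewrite mulmxBl mul1mx mulmx_suml; congr (_ - _).
    by apply: eq_bigr => i _; rewrite rank1_mul.
  rewrite -{1}(subrK (proj_on P e v) v) mulmxDr orthproj_id ?proj_on_orthocv //.
  rewrite orthproj_orthocv ?addr0 //; apply/orthocvP => w wW.
  by rewrite dotcvC; move/orthocvP: wW; apply; apply: mem_proj_on.
(* The action on the basis vector [delta_mx j 0] reads off column [j]. *)
by apply/matrixP => i j; move/matrixP: (act (delta_mx j 0)) => /(_ i 0);
  rewrite -!colE !mxE.
Qed.

Lemma free_orthonormal (s : seq I) :
  uniq s -> {in s, forall i, P i} -> free [seq e i | i <- s].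
Proof.
elim: s => [|i s IHs] /=; first by rewrite nil_free.
case/andP=> is_ us sP; rewrite free_cons IHs // ?andbT; last first.
  by move=> j js; apply: sP; rewrite inE js orbT.
have Pi : P i by apply: sP; rewrite mem_head.
apply/negP => ei; have : e i \in orthocv <<[seq e i | i <- s]>>.
  apply/orthocv_spanP => _ /mapP[j js ->].
  rewrite eP // ?sP // ?inE ?js ?orbT //.
  by case: eqP => // ij; rewrite ij js in is_.
move/orthocvP => /(_ _ ei) /eqP; by rewrite eP // eqxx oner_eq0.
Qed.

Lemma dim_orthocv_span_on : \dim (orthocv (span_on P e)) = (d - #|P|)%N.
Proof.
set V := span_on P e.
have VW : (V + orthocv V = fullv)%VS.
  apply/eqP; rewrite eqEsubv subvf /=; apply/subvP => v _.
  rewrite -(subrK (proj_on P e v) v) addrC memv_add ?mem_proj_on //.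
  exact: proj_on_orthocv.
have := dimv_disjoint_sum (capv_orthocv V); rewrite VW dimvf dim_matrix mulr1.
have -> : \dim V = #|P|.
  have : free [seq e i | i <- enum I & P i].
    apply: free_orthonormal; first by rewrite filter_uniq ?enum_uniq.
    by move=> i; rewrite mem_filter => /andP[].
  by rewrite /free => /eqP ->; rewrite size_map cardE enumT.
by move=> /(congr1 (subn^~ #|P|)) /=; rewrite addKn.
Qed.

End Orthonormal.

(** * Gram-Schmidt for possibly dependent vectors *)

Lemma unit_normalize (R : rcfType) d (u : 'cV[R]_d) :
  u != 0 -> exists2 s : R, s != 0 & dotcv (s *: u) (s *: u) = 1.
Proof.
move=> u0; have uu : 0 < dotcv u u := neq0_dnorm_gt0 _ u0.
exists (Num.sqrt (dotcv u u))^-1; first by rewrite invr_eq0 sqrtr_eq0 -ltNge.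
rewrite dotcvZl dotcvZr mulrA -expr2 exprVn sqr_sqrtr ?ltW // mulVf //.
by rewrite gt_eqF.
Qed.

(** The [g l] may be linearly dependent. If [g K] lies in the span already built, the new basis
    vector is any unit vector orthogonal to that span and [g K] gets coordinate 0 along it; such a
    vector exists since [k < d] at that stage. *)
Lemma gram_schmidt (R : rcfType) d n (g : 'I_n -> 'cV[R]_d) k :
  (k <= d)%N ->
  exists2 e : 'I_n -> 'cV[R]_d,
    orthonormal_on (fun i : 'I_n => i < k)%N e &
    forall l : 'I_n, (l < k)%N ->
      g l = \sum_(i < n | (i <= l)%N) dotcv (e i) (g l) *: e i.
Proof.
elim: k => [|k IHk] kd; first by exists (fun=> 0).
have [e eP eg] := IHk (ltnW kd).
have [nk|kn] := leqP n k.
  have ltk (i : 'I_n) : (i < k)%N by apply: leq_trans nk.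
  by exists e => [i j _ _|l _]; [apply: eP | apply: eg].
pose K := Ordinal kn; pose V := span_on (fun i : 'I_n => i < k)%N e.
have [t [w eK wK]] : exists t : R, exists2 w, dotcv w w = 1 /\
    (forall i : 'I_n, (i < k)%N -> dotcv (e i) w = 0) &
    g K = proj_on (fun i : 'I_n => i < k)%N e (g K) + t *: w.
  have residue w : w \notin V ->
      exists2 s : R, s != 0 &
        let u := s *: (w - proj_on (fun i : 'I_n => i < k)%N e w) in
        dotcv u u = 1 /\ forall i : 'I_n, (i < k)%N -> dotcv (e i) u = 0.
    move=> wV; have /unit_normalize[s s0 su] :
        w - proj_on (fun i : 'I_n => i < k)%N e w != 0.
      by apply: contraNneq wV => /subr0_eq ->; apply: mem_proj_on.
    exists s => //; split=> // i ik.
    by rewrite dotcvZr dotcvBr dotcv_proj_on // subrr mulr0.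
  (* Outside the span, the new vector is the residue of [g K] scaled by [s], so its coefficient is
     [s^-1]. *)
  have [gV|/residue[s s0 su]] := boolP (g K \in V); last first.
    exists s^-1; eexists; first exact: su.
    by rewrite scalerA mulVf // scale1r addrC subrK.
  (* The span is generated by at most [k] vectors, as [val] sends their indices injectively into
     [iota 0 k], so it is a proper subspace. *)
  have /subvPn[w _ /residue[s s0 su]] : ~~ (fullv <= V)%VS.
    apply/negP => /dimvS; apply/negP; rewrite -ltnNge dimvf dim_matrix mulr1.
    apply: leq_ltn_trans (dim_span _) _; rewrite size_map.
    apply: leq_ltn_trans kd; rewrite -(size_map val) -[leqRHS](size_iota 0).
    apply: uniq_leq_size.
      rewrite (map_inj_uniq val_inj); exact/filter_uniq/enum_uniq.
    by move=> j /mapP[i]; rewrite mem_filter mem_iota => /andP[ik _] ->.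
  exists 0; eexists; first exact: su.
  by rewrite scale0r addr0 -proj_on_id.
exists (fun i => if i == K then w else e i).
  have lt_k (i : 'I_n) : (i < k.+1)%N -> i != K -> (i < k)%N.
    by rewrite ltnS ltn_neqAle => -> iK; rewrite andbT.
  case: eK => w1 ew i j ik jk; case: (eqVneq i K) (lt_k i ik) => [-> _|iK /(_ isT) {}ik].
    case: (eqVneq j K) (lt_k j jk) => [-> _|jK /(_ isT) {}jk]; first by rewrite w1 ?eqxx.
    by rewrite dotcvC ew.
  case: (eqVneq j K) (lt_k j jk) => [-> _|jK /(_ isT) {}jk]; last exact: eP.
  by rewrite (negPf iK) ew.
move=> l; rewrite ltnS leq_eqVlt => /predU1P[lk|lk]; last first.
  rewrite [LHS]eg //; apply: eq_bigr => i il.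
  have -> // : (i == K) = false.
  by apply/negP => /eqP iK; move: il; rewrite iK leqNgt lk.
have -> : l = K by apply: val_inj.
rewrite (bigD1 K) //= eqxx.
have -> : dotcv w (g K) = t.
  case: eK => w1 ew; rewrite wK dotcvDr dotcvZr w1 mulr1.
  rewrite dotcv_sumr big1 ?add0r // => i ik.
  by rewrite dotcvZr [dotcv w _]dotcvC ew // mulr0.
rewrite [LHS]wK addrC; congr (_ + _); apply: eq_big => [i|i ik].
  by rewrite ltn_neqAle andbC.
by rewrite -val_eqE /= ltn_eqF.
Qed.

Lemma card_ord_lt n k : (k <= n)%N -> #|[pred i : 'I_n | (i < k)%N]| = k.
Proof.
move=> kn; have := @big_ord_widen _ 0%N addn k n (fun=> 1%N) kn.
by rewrite big_const_ord iter_addn_0 mul1n -sum1_card => {2}->.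
Qed.

(** * The operator [gram_op] and the comparison matrix [spike] *)

Section Prefix.
Variables (R : rcfType) (d n k : nat).
Variables (a : 'I_n -> R) (g : 'I_n -> 'cV[R]_d).

Definition gram_op : 'M[R]_d := \sum_(l < n) a l *: (g l *m (g l)^T).

(** For orthonormal [e] this has eigenvalue [lam + b i] at [e i] for [i < k], and [lam] on the
    orthogonal complement of these vectors. *)
Definition spike (lam : R) (b : 'I_n -> R) (e : 'I_n -> 'cV[R]_d) : 'M[R]_d :=
  lam%:M + \sum_(i < n | (i < k)%N) b i *: (e i *m (e i)^T).

Lemma fdot_spike lam b e A :
  fdot (spike lam b e) A =
  lam * \tr A + \sum_(i < n | (i < k)%N) b i * fdot (e i *m (e i)^T) A.
Proof.
rewrite fdotDl -scalemx1 fdotZl fdot_id1 fdot_suml; congr (_ + _).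
by apply: eq_bigr => i _; rewrite fdotZl.
Qed.

Lemma fdot_rank1_gram u :
  fdot (u *m u^T) gram_op = \sum_(l < n) a l * dotcv u (g l) ^+ 2.
Proof.
rewrite fdotC fdot_suml; apply: eq_bigr => l _.
by rewrite fdotZl fdotC fdot_rank1.
Qed.

Section SpikeOrthonormal.
Variables (lam : R) (b : 'I_n -> R) (e : 'I_n -> 'cV[R]_d).
Hypothesis eP : orthonormal_on (fun i : 'I_n => i < k)%N e.

Lemma fdot_rank1_spike (i : 'I_n) :
  (i < k)%N -> fdot (e i *m (e i)^T) (spike lam b e) = lam + b i.
Proof.
move=> ik; rewrite fdotC fdot_spike mxtrace_rank1 eP // eqxx mulr1.
rewrite (bigD1 i) //= big1 => [|j /andP[jk ji]].
  by rewrite fdot_rank1 eP // eqxx expr1n mulr1 addr0.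
by rewrite fdot_rank1 eP // (negPf ji) expr0n mulr0.
Qed.

Lemma mxtrace_spike :
  \tr (spike lam b e) = lam * d%:R + \sum_(i < n | (i < k)%N) b i.
Proof.
rewrite -fdot_id1 fdotC fdot_spike mxtrace1; congr (_ + _).
apply: eq_bigr => i ik.
by rewrite fdotC fdot_id1 mxtrace_rank1 eP // eqxx mulr1.
Qed.

Lemma frobenius_spike :
  frobenius (spike lam b e) ^+ 2 =
  lam * (lam * d%:R + \sum_(i < n | (i < k)%N) b i)
  + \sum_(i < n | (i < k)%N) b i * (lam + b i).
Proof.
rewrite -fdotE fdot_spike mxtrace_spike; congr (_ + _).
by apply: eq_bigr => i ik; rewrite fdot_rank1_spike.
Qed.

End SpikeOrthonormal.

Hypothesis a_gt0 : forall i, 0 < a i.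
Hypothesis g_unit : forall i, dotcv (g i) (g i) = 1.

Lemma mxtrace_gram : \tr gram_op = \sum_(l < n) a l.
Proof.
rewrite linear_sum; apply: eq_bigr => l _.
by rewrite /= mxtraceZ mxtrace_rank1 g_unit mulr1.
Qed.

(** * Energies of [gram_op] along a flag *)

Section Flag.
Variable e : 'I_n -> 'cV[R]_d.
Hypothesis eP : orthonormal_on (fun i : 'I_n => i < k)%N e.
Hypothesis eg : forall l : 'I_n, (l < k)%N ->
  g l = \sum_(i < n | (i <= l)%N) dotcv (e i) (g l) *: e i.

Lemma dotcv_flag_eq0 (i l : 'I_n) :
  (l < i)%N -> (i < k)%N -> dotcv (e i) (g l) = 0.
Proof.
move=> li ik; have lk := ltn_trans li ik.
rewrite eg // dotcv_sumr big1 // => j jl; rewrite dotcvZr eP //; last first.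
  exact: leq_ltn_trans lk.
by case: eqP => [ij|]; rewrite ?mulr0 //; rewrite ij ltnNge jl in li.
Qed.

(** The vector [g l] lies in the span of the [e i] with [i <= l]; summing on up to a larger [j] only
    adds zeros. The case [l < j] serves [flag_energy_eq], where one cutoff works for all earlier
    vectors. *)
Lemma parseval_flag (l j : 'I_n) : (l <= j)%N -> (j < k)%N ->
  \sum_(i < n | (i <= j)%N) dotcv (e i) (g l) ^+ 2 = 1.
Proof.
move=> lj jk; have lk := leq_ltn_trans lj jk.
rewrite (bigID (fun i : 'I_n => i <= l)%N) /= [X in _ + X]big1 => [|i]; last first.
  case/andP=> ij; rewrite -ltnNge => li.
  by rewrite dotcv_flag_eq0 ?expr0n // (leq_ltn_trans ij).
rewrite addr0 -(g_unit l) [X in _ = dotcv _ X]eg // dotcv_sumr.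
apply: eq_big => [i|i _]; last by rewrite dotcvZr dotcvC expr2.
by apply/andb_idl => il; apply: leq_trans lj.
Qed.

Variable b : 'I_n -> R.
Hypothesis b_ge0 : forall i : 'I_n, (i < k)%N -> 0 <= b i.
Hypothesis b_noninc :
  forall i j : 'I_n, (i <= j)%N -> (j < k)%N -> b j <= b i.

Lemma flag_energy_ge :
  \sum_(i < n | (i < k)%N) b i * a i <=
  \sum_(i < n | (i < k)%N) b i * fdot (e i *m (e i)^T) gram_op.
Proof.
have -> : \sum_(i < n | (i < k)%N) b i * fdot (e i *m (e i)^T) gram_op =
    \sum_(l < n) \sum_(i < n | (i < k)%N) b i * (a l * dotcv (e i) (g l) ^+ 2).
  rewrite exchange_big /=; apply: eq_bigr => i _.
  by rewrite fdot_rank1_gram mulr_sumr.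
have term_ge0 (l i : 'I_n) :
    (i < k)%N -> 0 <= b i * (a l * dotcv (e i) (g l) ^+ 2).
  by move=> ik; rewrite mulr_ge0 ?b_ge0 // mulr_ge0 ?sqr_ge0 // ltW.
rewrite [leRHS](bigID (fun l : 'I_n => l < k)%N) /= -[leLHS]addr0 lerD //.
  apply: ler_sum => l lk; rewrite -[leLHS]mulr1 -(parseval_flag (leqnn l) lk).
  rewrite [leRHS](bigID (fun i : 'I_n => i <= l)%N) /= -[leLHS]addr0 lerD //.
    rewrite !mulr_sumr [leRHS](eq_bigl (fun i : 'I_n => i <= l)%N); last first.
      by move=> i; apply/andb_idl => il; apply: leq_ltn_trans lk.
    apply: ler_sum => i il; rewrite -mulrA; apply: ler_wpM2r; last exact: b_noninc.
    by rewrite mulr_ge0 ?sqr_ge0 // ltW.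
  by apply: sumr_ge0 => i /andP[ik _]; apply: term_ge0.
by apply: sumr_ge0 => l _; apply: sumr_ge0 => i; apply: term_ge0.
Qed.

(* Summed over [i <= j], the energies already reach the total weight of the
   vectors of index at most [j], so the later vectors contribute nothing. *)
Lemma flag_energy_eq :
  (forall i : 'I_n, (i < k)%N -> fdot (e i *m (e i)^T) gram_op = a i) ->
  forall i l : 'I_n, (i < k)%N -> (i < l)%N -> dotcv (e i) (g l) = 0.
Proof.
move=> Ea i l ik il.
have : \sum_(j < n | (j <= i)%N) fdot (e j *m (e j)^T) gram_op =
       \sum_(j < n | (j <= i)%N) a j.
  by apply: eq_bigr => j ji; rewrite Ea // (leq_ltn_trans ji).
rewrite (eq_bigr (fun j => \sum_(l < n) a l * dotcv (e j) (g l) ^+ 2)) => [|j _].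
  rewrite exchange_big /= (bigID (fun l : 'I_n => l <= i)%N) /=.
  rewrite (eq_bigr a) => [|j ji]; last first.
    by rewrite -mulr_sumr (parseval_flag ji ik) mulr1.
  move/eqP; rewrite addrC -subr_eq0 addrK => /eqP.
  have ge0 (u v : 'I_n) : 0 <= a u * dotcv (e v) (g u) ^+ 2.
    by rewrite mulr_ge0 ?sqr_ge0 // ltW.
  move=> sum0; have il' : ~~ (l <= i)%N by rewrite -ltnNge.
  have term0 := psumr_eq0P (fun u _ => sumr_ge0 _ (fun v _ => ge0 u v)) sum0 il'.
  have /eqP := psumr_eq0P (fun v _ => ge0 l v) term0 (leqnn i).
  by rewrite mulf_eq0 gt_eqF //= sqrf_eq0 => /eqP.
by rewrite fdot_rank1_gram.
Qed.

End Flag.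

(** * The lower bound and its equality case *)

Hypotheses (kd : (k <= d)%N) (kn : (k <= n)%N).
Variable lam : R.
Let b i := a i - lam.
Hypothesis b_ge0 : forall i : 'I_n, (i < k)%N -> 0 <= b i.
Hypothesis a_noninc :
  forall i j : 'I_n, (i <= j)%N -> (j < k)%N -> a j <= a i.
Hypothesis tail_sum : \sum_(i < n | (k <= i)%N) a i = (d - k)%:R * lam.

(** The sum of the squared eigenvalues of [spike lam b e]: [a i] once for each [i < k], and [lam]
    with multiplicity [d - k]. *)
Let level := \sum_(i < n | (i < k)%N) a i ^+ 2 + (d - k)%:R * lam ^+ 2.

Lemma sum_prefix_shift :
  lam * d%:R + \sum_(i < n | (i < k)%N) b i =
  \sum_(i < n | (i < k)%N) a i + (d - k)%:R * lam.
Proof.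
rewrite big_split /= sumr_const card_ord_lt // mulNrn -[d in LHS](subnK kd).
by rewrite natrD mulrDr mulr_natr [lam * k%:R]mulr_natr addrCA addrK mulr_natl.
Qed.

(** These are the traces of [gram_op] and of [spike lam b e]. They agree because [lam] spreads the
    tail weight evenly over the remaining [d - k] directions. *)
Lemma sum_gram_weights :
  \sum_(l < n) a l = lam * d%:R + \sum_(i < n | (i < k)%N) b i.
Proof.
rewrite sum_prefix_shift (bigID (fun l : 'I_n => l < k)%N) /= -tail_sum.
by congr (_ + _); apply: eq_bigl => l; rewrite -leqNgt.
Qed.

Lemma frobenius_spike_level e :
  orthonormal_on (fun i : 'I_n => i < k)%N e ->
  frobenius (spike lam b e) ^+ 2 = level.
Proof.
move=> eP; rewrite frobenius_spike // sum_prefix_shift /level.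
rewrite mulrDr mulr_sumr addrAC -big_split /= mulrCA -expr2; congr (_ + _).
by apply: eq_bigr => i _; rewrite /b [lam + _]addrC subrK -mulrDl addrC subrK expr2.
Qed.

(** With [g] itself in the role of [e], the terms of index below [k] occur on both sides with the
    same coefficient [a i] and cancel. What remains is the placement identity, once the last factor
    is recognized as a projection. *)
Lemma gram_eq_spike :
  gram_op = spike lam b g <->
  \sum_(l < n | (k <= l)%N) a l *: (g l *m (g l)^T) =
    lam *: (1%:M - \sum_(i < n | (i < k)%N) g i *m (g i)^T).
Proof.
have -> : spike lam b g = \sum_(i < n | (i < k)%N) a i *: (g i *m (g i)^T)
    + lam *: (1%:M - \sum_(i < n | (i < k)%N) g i *m (g i)^T).
  rewrite /spike -[lam%:M]scalemx1 scalerBr scaler_sumr addrCA; congr (_ + _).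
  by rewrite -sumrB; apply: eq_bigr => i _; rewrite -scalerBl.
rewrite /gram_op (bigID (fun l : 'I_n => l < k)%N) /=.
under [X in _ + X]eq_bigl => l do rewrite -leqNgt.
by split=> [/addrI|->].
Qed.

Lemma frobenius_gram :
  level <= frobenius gram_op ^+ 2 /\
  (frobenius gram_op ^+ 2 = level ->
   [/\ orthonormal_on (fun i : 'I_n => i < k)%N g,
       forall i l : 'I_n, (i < k)%N -> (k <= l)%N -> dotcv (g i) (g l) = 0 &
       gram_op = spike lam b g]).
Proof.
have [e eP eg] := gram_schmidt g kd.
have b_noninc (i j : 'I_n) : (i <= j)%N -> (j < k)%N -> b j <= b i.
  by move=> ij jk; rewrite lerD2r a_noninc.
set X := spike lam b e; pose D := gram_op - X.
have XD : 0 <= fdot X D.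
  rewrite fdotC fdotDl -scaleN1r fdotZl mulN1r ![fdot _ X]fdotC fdotE.
  rewrite subr_ge0 frobenius_spike_level // fdot_spike.
  (* The contributions of [lam%:M] cancel because the traces agree; the flag inequality bounds the
     rest. *)
  apply: le_trans (lerD (lexx _) (flag_energy_ge eP eg b_ge0 b_noninc)).
  rewrite mxtrace_gram sum_gram_weights -(frobenius_spike_level eP).
  rewrite frobenius_spike // lerD2l ler_sum // => i _.
  by rewrite [lam + _]addrC subrK.
have GE : frobenius gram_op ^+ 2 = level + 2 * fdot X D + frobenius D ^+ 2.
  by rewrite -(frobenius_spike_level eP) -frobenius_sqrD addrC subrK.
have D0 : 0 <= frobenius D ^+ 2 by apply: sqr_ge0.
have XD2 : 0 <= 2 * fdot X D by rewrite pmulr_rge0 ?ltr0n.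
rewrite GE -addrA lerDl; split; first exact: addr_ge0.
(* Equality makes two nonnegative terms add up to 0, hence [D = 0] and [gram_op = X]. *)
move=> /eqP; rewrite -subr_eq0 addrAC subrr add0r paddr_eq0 //.
case/andP=> _; rewrite frobenius_sqr_eq0 subr_eq0 => /eqP GX.
have Ge (i : 'I_n) : (i < k)%N -> fdot (e i *m (e i)^T) gram_op = a i.
  by move=> ik; rewrite GX fdot_rank1_spike // addrC subrK.
have e0 := flag_energy_eq eP eg Ge.
(* The flag leaves only coordinates [j <= i], and [e0] removes those with [j < i]. The remaining
   coefficient is a sign, which disappears from [g i *m (g i)^T]. *)
have ge (i : 'I_n) : (i < k)%N -> g i = dotcv (e i) (g i) *: e i.
  move=> ik; rewrite [LHS]eg // (bigD1 i) //= big1 ?addr0 // => j /andP[ji jni].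
  have lt_ji : (j < i)%N by rewrite ltn_neqAle jni.
  by rewrite e0 ?scale0r // (ltn_trans lt_ji).
have t1 (i : 'I_n) : (i < k)%N -> dotcv (e i) (g i) ^+ 2 = 1.
  move=> ik; rewrite -(g_unit i) [in RHS]ge // dotcvZl dotcvZr.
  by rewrite eP // eqxx mulr1 expr2.
have gP : orthonormal_on (fun i : 'I_n => i < k)%N g.
  move=> i j ik jk; have [->|ij] := eqVneq i j; first exact: g_unit.
  by rewrite (ge i ik) (ge j jk) dotcvZl dotcvZr eP // (negPf ij) !mulr0.
split=> // [i l ik kl|].
  by rewrite (ge i ik) dotcvZl (e0 i l) ?mulr0 // (leq_trans ik).
rewrite GX; congr (_ + _); apply: eq_bigr => i ik; congr (_ *: _).
rewrite (ge i ik) linearZ /= -scalemxAl -scalemxAr scalerA -expr2.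
by rewrite t1 // scale1r.
Qed.

End Prefix.

(** By minimality the irregularity condition fails at the index [K] just before [k0]. With
    [m = d - k0], [x = c K ^+ 2] and tail sum [T] from [k0] on, the failure reads
    [(x + T) / (m + 1) < x], that is [T / m < x]; earlier terms are at least [x]. *)
Lemma irregularity_weights (R : realFieldType) d n (c : 'I_n -> R) (k0 : 'I_n) :
  (forall i, 0 < c i) ->
  (forall i j : 'I_n, (i <= j)%N -> c j <= c i) ->
  is_irregularity d c k0 -> (1 <= k0)%N ->
  forall i : 'I_n, (i < k0)%N ->
    (d - k0)%:R^-1 * \sum_(j < n | (k0 <= j)%N) c j ^+ 2 <= c i ^+ 2.
Proof.
move=> c_gt0 c_noninc [[k0d _] k0_min] k0_ge1 i ik.
have Kn : (k0.-1 < n)%N by rewrite (leq_ltn_trans (leq_pred _)).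
pose K := Ordinal Kn; have K1 : K.+1 = k0 by rewrite /= prednK.
have Kd : (K < d)%N by rewrite (ltn_trans _ k0d) // -K1.
apply: (@le_trans _ _ (c K ^+ 2)); last first.
  rewrite lerXn2r ?nnegrE ?(ltW (c_gt0 _)) // c_noninc //.
  by rewrite -ltnS K1.
have : (d - K)%:R^-1 * \sum_(j < n | (K <= j)%N) c j ^+ 2 < c K ^+ 2.
  rewrite ltNge; apply/negP => cK; have := k0_min K (conj Kd cK).
  by rewrite -K1 ltnn.
have -> : \sum_(j < n | (K <= j)%N) c j ^+ 2 =
    c K ^+ 2 + \sum_(j < n | (k0 <= j)%N) c j ^+ 2.
  rewrite (bigD1 K) //=; congr (_ + _); apply: eq_bigl => j.
  by rewrite -K1 ltn_neqAle andbC eq_sym.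
have -> : (d - K)%N = (d - k0).+1 by rewrite -K1 -subnSK.
have m_gt0 : (0 : R) < (d - k0)%:R by rewrite ltr0n subn_gt0.
rewrite ler_pdivrMl // ltr_pdivrMl ?ltr0n // -natr1 mulrDl mul1r addrC.
by rewrite ltrD2r => /ltW.
Qed.

Theorem mainTheorem3 (R : realType) (d n : nat)
    (d23 : (d = 2 \/ d = 3)%N) (le_d_n : (d <= n)%N)
    (c : 'I_n -> R)
    (c_gt0 : forall i, 0 < c i)
    (c_noninc : forall i j : 'I_n, (i <= j)%N -> c j <= c i)
    (k0 : 'I_n) (k0_irr : is_irregularity d c k0) (k0_ge1 : (1 <= k0)%N)
    (g : 'I_n -> 'cV[R]_d) (g_unit : forall i, frobenius (g i) = 1) :
  let G : 'M[R]_d := \sum_(i < n) c i ^+ 2 *: (g i *m (g i)^T) in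
  let bound : R :=
    \sum_(i < n | (i < k0)%N) c i ^+ 4
    + (d - k0)%:R^-1 * (\sum_(i < n | (k0 <= i)%N) c i ^+ 2) ^+ 2 in
  bound <= frobenius G ^+ 2 /\
  (frobenius G ^+ 2 = bound <->
    (forall i j : 'I_n, (i < k0)%N -> (j < k0)%N -> i != j ->
       dotcv (g i) (g j) = 0) /\
    regular_optimal_placement (d - k0)
      (orthocv <<[seq g i | i : 'I_n <- enum 'I_n & (i < k0)%N]>>%VS)
      [set i : 'I_n | (k0 <= i)%N] c g).
Proof.
move=> G bound; have k0d : (k0 < d)%N by case: k0_irr => -[].
have kd := ltnW k0d; have kn := ltnW (ltn_ord k0).
pose a i := c i ^+ 2; pose S := \sum_(i < n | (k0 <= i)%N) a i.
pose lam := (d - k0)%:R^-1 * S.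
have m0 : (d - k0)%:R != 0 :> R by rewrite pnatr_eq0 -lt0n subn_gt0.
have a_gt0 i : 0 < a i by rewrite exprn_gt0.
have gg i : dotcv (g i) (g i) = 1 by rewrite -frobenius_cv g_unit expr1n.
have b_ge0 (i : 'I_n) : (i < k0)%N -> 0 <= a i - lam.
  by move=> ik; rewrite subr_ge0; apply: irregularity_weights.
have a_noninc (i j : 'I_n) : (i <= j)%N -> (j < k0)%N -> a j <= a i.
  by move=> ij _; rewrite lerXn2r ?nnegrE ?(ltW (c_gt0 _)) // c_noninc.
have tailE : S = (d - k0)%:R * lam by rewrite mulVKf.
have levelE : bound =
    \sum_(i < n | (i < k0)%N) a i ^+ 2 + (d - k0)%:R * lam ^+ 2.
  rewrite /bound; congr (_ + _).
    by apply: eq_bigr => i _; rewrite -exprM.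
  (* With [m = d - k0] and [S = m * lam], both [S ^+ 2 / m] and [m * lam ^+ 2] equal [S * lam]. *)
  by rewrite [lam ^+ 2]expr2 mulrA -tailE expr2 mulrCA.
have [ge_level eq_level] := frobenius_gram a_gt0 gg kd kn b_ge0 a_noninc tailE.
rewrite -levelE -/G in ge_level eq_level; split=> //.
(* Generic in [T], since the placement identity contains both a matrix sum and a scalar sum over the
   index set. *)
have setE (T : nmodType) (F : 'I_n -> T) :
    \sum_(i in [set i : 'I_n | (k0 <= i)%N]) F i = \sum_(i < n | (k0 <= i)%N) F i.
  by apply: eq_bigl => i; rewrite inE.
split=> [/eq_level[gP g_tail GX]|[g_orth [_ _ _ placement]]].
  split=> [i j ik jk ij|]; first by rewrite gP // (negPf ij).
  split=> [|i _|i|]; [|exact: g_unit| |].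
  - by rewrite (dim_orthocv_span_on gP) card_ord_lt.
  - rewrite inE => ki; apply: (@orthocv_span_onP _ _ _ (fun i : 'I_n => i < k0)%N).
    by move=> j jk; apply: g_tail.
  rewrite !setE (orthproj_orthocv_span_on gP) -/S -/lam.
  exact/(gram_eq_spike k0 a g lam).1.
(* Conversely, orthogonality makes the first [k0] unit vectors orthonormal, the placement identity
   turns [G] into a spike on them, and its norm is known. *)
have gP : orthonormal_on (fun i : 'I_n => i < k0)%N g.
  by move=> i j ik jk; have [->|ij] := eqVneq i j; [apply: gg | apply: g_orth].
rewrite !setE (orthproj_orthocv_span_on gP) in placement.
have -> : G = spike k0 lam (fun i => a i - lam) g by apply/gram_eq_spike.
by rewrite levelE; apply: frobenius_spike_level.
Qed.
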